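(* Let $M$ be a quasi-projective strongly harmonic left $R$-module and let $N$ be a fully invariant submodule of $M$. Then $M/N$ is a strongly harmonic module.
   Context: $R$ is an associative ring with identity; modules are unital left $R$-modules. A submodule $N\leq M$ is fully invariant if $f(N)\subseteq N$ for all $f\in\mathrm{End}_R(M)$; $\Lambda^{fi}(M)$ is the lattice of fully invariant submodules of $M$ ordered by inclusion, and $Max^{fi}(M)$ is the set of coatoms (maximal proper elements) of $\Lambda^{fi}(M)$. $M$ is quasi-projective if for every epimorphism $\rho\colon M\to X$ and every homomorphism $\alpha\colon M\to X$ there is $\beta\colon M\to M$ with $\rho\beta=\alpha$. For $N,L\leq M$ put $N_ML=\sum\{f(N)\mid f\in\mathrm{Hom}_R(M,L)\}$. A module $M$ is strongly harmonic if for every two distinct $N,L\in Max^{fi}(M)$ there exist $N',L'\in\Lambda^{fi}(M)$ with $L'\nleq L$, $N'\nleq N$ and $L'_MN'=0$. *)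

(* Defs.v *)
From HB Require Import structures.
From mathcomp Require Import all_boot all_order all_algebra.
From mathcomp Require Import boolp classical_sets.
Set Implicit Arguments.
Unset Strict Implicit.
Unset Printing Implicit Defensive.
Import GRing.Theory.
Local Open Scope ring_scope.
Local Open Scope quotient_scope.

(* Submodules are MathComp's [submodClosed M]: boolean predicates closed under *)
(* 0, + and scaling. With the classical axioms of [boolp] every submodule has  *)
(* such a membership predicate. Inclusion is [{subset N <= L}] and equality of *)
(* submodules is extensional equality [N =i L].                                *)

(* [submodClosed] is stated over semirings and does not record closure under   *)
(* opposite, which [Quotient.quot] needs.                                      *)
Section Quotient.
Variables (R : pzRingType) (M : lmodType R) (N : submodClosed M).

Definition submod_pred : {pred M} := [in N].

Fact submod_pred_zmod : zmod_closed submod_pred.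
Proof. exact: (GRing.submod_closedB (submodClosedP N)). Qed.
HB.instance Definition _ := GRing.isZmodClosed.Build M submod_pred submod_pred_zmod.

Definition quot_mod : Type := Quotient.quot submod_pred.
HB.instance Definition _ := ZmodQuotient.on quot_mod.

Lemma quot_modE (x y : M) :
  (\pi_quot_mod x == \pi_quot_mod y) = (x - y \in N).
Proof. by rewrite -Quotient.idealrBE. Qed.

Definition quot_scale (a : R) : quot_mod -> quot_mod :=
  lift_op1 quot_mod (fun x : M => a *: x).

Lemma pi_scale a : {morph \pi_quot_mod : x / a *: x >-> quot_scale a x}.
Proof.
move=> x; unlock quot_scale; apply/eqP.
by rewrite quot_modE -scalerBr rpredZ // -quot_modE reprK.
Qed.

Fact quot_scaleA a b x : quot_scale a (quot_scale b x) = quot_scale (a * b) x.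
Proof. by rewrite -[x]reprK -!pi_scale scalerA. Qed.

Fact quot_scale1 : left_id 1 quot_scale.
Proof. by move=> x; rewrite -[x]reprK -!pi_scale scale1r. Qed.

Fact quot_scaleDr : right_distributive quot_scale +%R.
Proof.
by move=> a x y; rewrite -[x]reprK -[y]reprK -raddfD -!pi_scale scalerDr raddfD.
Qed.

Fact quot_scaleDl x : {morph quot_scale^~ x : a b / a + b}.
Proof. by move=> a b; rewrite -[x]reprK -!pi_scale scalerDl raddfD. Qed.

HB.instance Definition _ := GRing.Zmodule_isLmodule.Build R quot_mod
  quot_scaleA quot_scale1 quot_scaleDr quot_scaleDl.

(* The projection M -> M/N is additive by ZmodQuotient; with scaling it is linear. *)
HB.instance Definition _ := GRing.isScalable.Build R M quot_mod *:%R
  (\pi_quot_mod) pi_scale.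

End Quotient.

Notation "M '/m' N" := (@quot_mod _ M N) (at level 40) : type_scope.

Section Definitions.
Variables (R : pzRingType) (M : lmodType R).
Implicit Types N L K : submodClosed M.

Definition fully_invariant N : Prop :=
  forall f : {linear M -> M}, {in N, forall x, f x \in N}.

Definition max_fi N : Prop :=
  [/\ fully_invariant N, ~ (N =i predT) &
      forall K, fully_invariant K -> {subset N <= K} -> K =i N \/ K =i predT].

(* In the category of R-modules the epimorphisms are the surjections. *)
Definition quasi_projective : Prop :=
  forall (X : lmodType R) (rho : {linear M -> X}),
    (forall y : X, exists x : M, rho x = y) ->
  forall alpha : {linear M -> X},
    exists beta : {linear M -> M}, forall x : M, rho (beta x) = alpha x.

(* N_M L; Hom_R(M, L) is rendered by the endomorphisms of M with values in L. *)
Definition mod_prod N L : set M :=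
  [set x | exists (n : nat) (f : 'I_n -> {linear M -> M}) (y : 'I_n -> M),
     [/\ forall i z, f i z \in L, forall i, y i \in N
       & x = \sum_(i < n) f i (y i)]].

Definition strongly_harmonic : Prop :=
  forall N L, max_fi N -> max_fi L -> ~ (N =i L) ->
  exists N' L' : submodClosed M,
    [/\ fully_invariant N', fully_invariant L',
        ~ {subset L' <= L}, ~ {subset N' <= N}
      & mod_prod L' N' = [set 0]%classic].

End Definitions.

Arguments quasi_projective {R} M.
Arguments strongly_harmonic {R} M.

(* Main.v *)
Require Import Defs.
From HB Require Import structures.
From mathcomp Require Import all_boot all_order all_algebra.
From mathcomp Require Import boolp classical_sets.
Import GRing.Theory.
Local Open Scope ring_scope.
Local Open Scope quotient_scope.

(** The coatoms of the lattice of fully invariant submodules of M/N pull back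
    along the projection pi : M -> M/N to coatoms of that lattice for M, and
    distinct ones stay distinct. Two facts make this work. Since N is fully
    invariant, every endomorphism of M descends to M/N, so preimages of fully
    invariant submodules are fully invariant ([preim_fi]). Since M is
    quasi-projective, every endomorphism of M/N lifts to M, so images of fully
    invariant submodules are fully invariant ([im_fi]).

    Strong harmonicity of M then separates the two preimages by N' and L' with
    L'_M N' = 0, and pi N', pi L' separate the original pair. What remains is
    that (pi L')_(M/N) (pi N') = 0, and this rests on a sharper lifting: a
    homomorphism g : M -> M/N with values in pi N' lifts to an endomorphism of
    M whose values lie in N' itself, and not merely in N' + N
    ([quasi_projective_lift]). Hence each f : M/N -> pi N' is induced by some
    h : M -> N', which kills L' because L'_M N' = 0, so f kills pi L'. *)

Section Submodules.
Context {R : pzRingType} {M : lmodType R}.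

(** Serves for images in particular, whose natural description is an
    existential statement and not a boolean. *)
Lemma submod_of_prop (P : M -> Prop) :
  P 0 -> (forall a x y, P x -> P y -> P (a *: x + y)) ->
  exists K : submodClosed M, forall x, x \in K <-> P x.
Proof.
move=> P0 Plin.
pose p : {pred M} := fun x => `[< P x >].
have pP x : x \in p <-> P x by split=> /asboolP.
have pS : GRing.subsemimod_closed p.
  split; first split.
  - exact/pP.
  - by move=> x y /pP Px /pP Py; apply/pP; rewrite -[x]scale1r; apply: Plin.
  - by move=> a x /pP Px; apply/pP; rewrite -[_ *: _]addr0; apply: Plin.
pose pC := GRing.isSubmodClosed.Build R M p pS.
pose K : submodClosed M := HB.pack p pC.
by exists K.
Qed.

Lemma submod_cap (A B : submodClosed M) :
  exists K : submodClosed M, forall x, x \in K <-> x \in A /\ x \in B.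
Proof.
apply: submod_of_prop => [|a x y [xA xB] [yA yB]]; first by rewrite !rpred0.
by split; apply: rpredD => //; apply: rpredZ.
Qed.

Lemma submod_preim {V : lmodType R} (g : {linear M -> V}) (A : submodClosed V) :
  exists K : submodClosed M, forall x, x \in K <-> g x \in A.
Proof.
apply: submod_of_prop => [|a x y xA yA]; first by rewrite linear0 rpred0.
by rewrite linearP rpredD // rpredZ.
Qed.

Lemma submod_im {V : lmodType R} (g : {linear V -> M}) (A : submodClosed V) :
  exists K : submodClosed M, forall y, y \in K <-> exists2 x, x \in A & g x = y.
Proof.
apply: submod_of_prop => [|a _ _ [x xA <-] [y yA <-]].
  by exists 0; rewrite ?rpred0 ?linear0.
by exists (a *: x + y); rewrite ?linearP // rpredD // rpredZ.
Qed.

End Submodules.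

(** A submodule of U x V that projects onto U and meets 0 x V trivially is the
    graph of a linear map. Both uses below describe a map through an
    element chosen above a given coset, where no choice is canonical but all
    lead to the same value. *)
Lemma linear_of_graph (R : pzRingType) (U V : lmodType R) (P : U -> V -> Prop) :
  (forall x, exists v, P x v) -> (forall v, P 0 v -> v = 0) ->
  (forall a x y v w, P x v -> P y w -> P (a *: x + y) (a *: v + w)) ->
  exists h : {linear U -> V}, forall x, P x (h x).
Proof.
move=> /choice[h hP] P0 Plin.
have h_lin : linear h.
  move=> a x y; apply/eqP; rewrite -subr_eq0; apply/eqP/P0.
  have := Plin (-1) _ _ _ _ (Plin a _ _ _ _ (hP x) (hP y)) (hP (a *: x + y)).
  by rewrite !scaleN1r addNr [- _ + _]addrC.
pose hL := GRing.isLinear.Build R U V *:%R h h_lin.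
pose H : {linear U -> V} := HB.pack h hL.
by exists H.
Qed.

Section Projection.
Context {R : pzRingType} {M : lmodType R} (N : submodClosed M).

Definition qproj : {linear M -> M /m N} := \pi_(quot_mod N).

Lemma qproj_surj (y : M /m N) : exists x, qproj x = y.
Proof. by exists (repr y); apply: reprK. Qed.

Lemma qproj_eq x y : qproj x = qproj y <-> x - y \in N.
Proof. by rewrite -quot_modE; split=> /eqP. Qed.

Lemma qproj_ker x : qproj x = 0 <-> x \in N.
Proof. by rewrite -(linear0 qproj) qproj_eq subr0. Qed.

Lemma qproj_descend {V : lmodType R} (g : {linear M -> V}) :
  (forall x, x \in N -> g x = 0) ->
  exists h : {linear M /m N -> V}, forall x, h (qproj x) = g x.
Proof.
move=> gN.
have [||a _ _ _ _ [x <- <-] [y <- <-]|h hP] :=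
  @linear_of_graph R (M /m N) V (fun y v => exists2 x, qproj x = y & g x = v).
- by move=> y; have [x xy] := qproj_surj y; exists (g x), x.
- by move=> v [x /qproj_ker xN <-]; apply: gN.
- by exists (a *: x + y); rewrite linearP.
exists h => x; have [z /qproj_eq zx <-] := hP (qproj x).
by apply/eqP; rewrite -subr_eq0 -linearB gN.
Qed.

End Projection.

(** Quasi-projectivity concerns epimorphisms out of M, whereas here a map has
    to be lifted along A -> (A + N)/N. As (A + N)/N is A/(A :&: N), a submodule
    of M/(A :&: N), the map can be lifted along M -> M/(A :&: N) instead; the
    lift lands in A because A contains the kernel. *)
Lemma quasi_projective_lift (R : pzRingType) (M : lmodType R)
    (N A : submodClosed M) (g : {linear M -> M /m N}) :
  quasi_projective M -> (forall x, exists2 z, z \in A & qproj N z = g x) ->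
  exists h : {linear M -> M}, forall x, h x \in A /\ qproj N (h x) = g x.
Proof.
move=> qpM gA; have [K KE] := submod_cap A N.
have [||a x y _ _ [z [zA zx <-]] [w [wA wy <-]]|alpha alphaP] :=
  @linear_of_graph R M (M /m K)
    (fun x v => exists z, [/\ z \in A, qproj N z = g x & qproj K z = v]).
- by move=> x; have [z zA zx] := gA x; exists (qproj K z), z.
- move=> v [z [zA]]; rewrite linear0 => /qproj_ker zN <-.
  by apply: (proj2 (qproj_ker K z)); apply/KE.
- by exists (a *: z + w); rewrite !linearP zx wy rpredD // rpredZ.
have [h hE] := qpM _ _ (qproj_surj K) alpha.
exists h => x; have [z [zA <- zh]] := alphaP x.
have /KE[hzA hzN] : h x - z \in K by apply/qproj_eq; rewrite hE -zh.
by split; [rewrite -(subrK z (h x)) rpredD | apply/qproj_eq].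
Qed.

Section QuotientInvariance.
Context {R : pzRingType} {M : lmodType R} (N : submodClosed M).

Lemma preim_fi (K : submodClosed M) (A : submodClosed (M /m N)) :
  fully_invariant N -> fully_invariant A ->
  (forall x, x \in K <-> qproj N x \in A) -> fully_invariant K.
Proof.
move=> fiN fiA KA f x /KA xA; apply/KA.
have [y /fiN fyN|h hE] := qproj_descend N (qproj N \o f).
  exact/qproj_ker.
by have := fiA h _ xA; rewrite hE.
Qed.

Lemma im_fi (K : submodClosed M) (A : submodClosed (M /m N)) :
  quasi_projective M -> fully_invariant K ->
  (forall y, y \in A <-> exists2 x, x \in K & qproj N x = y) ->
  fully_invariant A.
Proof.
move=> qpM fiK AK f _ /AK[x xK <-]; apply/AK.
have [h hE] := qpM _ _ (qproj_surj N) (f \o qproj N).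
by exists (h x); [exact: fiK | exact: hE].
Qed.

(** A fully invariant B above the preimage K of A contains N, hence is the
    preimage of its own image C. Quasi-projectivity makes C fully invariant, so
    the maximality of A decides C, and with it B. *)
Lemma preim_max_fi (K : submodClosed M) (A : submodClosed (M /m N)) :
  quasi_projective M -> fully_invariant N -> max_fi A ->
  (forall x, x \in K <-> qproj N x \in A) -> max_fi K.
Proof.
move=> qpM fiN [fiA A_proper A_max] KA; split; first exact: preim_fi KA.
  move=> KT; apply: A_proper => y; have [x <-] := qproj_surj N y.
  by apply/KA; rewrite KT.
move=> B fiB KB.
have [C CB] := submod_im (qproj N) B.
(* N lies in K, the preimage of A, because 0 is in A; hence N lies in B *)
have BC x : x \in B <-> qproj N x \in C.
  split=> [xB|/CB[z zB /esym/qproj_eq xz]]; first by apply/CB; exists x.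
  have xzB : x - z \in B.
    by apply/KB/KA; rewrite (proj2 (qproj_ker N _) xz) rpred0.
  by rewrite -(subrK z x) rpredD.
have fiC : fully_invariant C by exact: im_fi CB.
have AC : {subset A <= C}.
  move=> y; have [x <-] := qproj_surj N y => /KA xK; exact/BC/KB.
have [CA|CT] := A_max C fiC AC; [left | right] => x.
  by apply/idP/idP => [/BC|/KA]; [rewrite CA => /KA | rewrite -CA => /BC].
by apply/BC; rewrite CT.
Qed.

End QuotientInvariance.

Section ModProd.
Context {R : pzRingType} {M : lmodType R}.

(** The product is spanned by the values f x, so it vanishes as soon as these
    do; this removes the finite sums from every later argument. *)
Lemma mod_prod_eq0 (L K : submodClosed M) :
  mod_prod L K = [set 0]%classic <->
  forall (f : {linear M -> M}) x, (forall z, f z \in K) -> x \in L -> f x = 0.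
Proof.
split=> [LK0 f x fK xL|LK0].
  suff: mod_prod L K (f x) by rewrite LK0.
  by exists 1%N, (fun=> f), (fun=> x); split; rewrite ?big_ord1.
apply/seteqP; split=> [_ [n [f [y [fK yL ->]]]]|_ ->] /=.
  by apply: big1 => i _; apply: LK0.
by exists 0%N, (fun=> idfun), (fun=> 0); split; rewrite ?big_ord0 // => -[].
Qed.

End ModProd.

(** A map f : M/N -> pi K, composed with pi, lifts to an h : M -> K. This h
    vanishes on L because L_M K = 0, and therefore f vanishes on pi L. *)
Lemma mod_prod_im_eq0 (R : pzRingType) (M : lmodType R) (N L K : submodClosed M)
    (LN KN : submodClosed (M /m N)) :
  quasi_projective M ->
  (forall y, y \in LN <-> exists2 x, x \in L & qproj N x = y) ->
  (forall y, y \in KN <-> exists2 x, x \in K & qproj N x = y) ->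
  mod_prod L K = [set 0]%classic -> mod_prod LN KN = [set 0]%classic.
Proof.
move=> qpM LNE KNE /mod_prod_eq0 LK0.
apply/mod_prod_eq0 => f _ fKN /LNE[x xL <-].
have [z|h hP] := @quasi_projective_lift _ _ N K (f \o qproj N) qpM.
  exact/KNE/fKN.
have hK z : h z \in K by have [] := hP z.
by have [_ /= <-] := hP x; rewrite (LK0 h x hK xL) linear0.
Qed.

Theorem proposition4p5 (R : pzRingType) (M : lmodType R) (N : submodClosed M) :
  quasi_projective M -> strongly_harmonic M -> fully_invariant N ->
  strongly_harmonic (M /m N).
Proof.
move=> qpM shM fiN A B maxA maxB neqAB.
have [A' A'E] := submod_preim (qproj N) A.
have [B' B'E] := submod_preim (qproj N) B.
have neqAB' : ~ (A' =i B').
  move=> eqAB; apply: neqAB => y; have [x <-] := qproj_surj N y.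
  by apply/idP/idP => [/A'E|/B'E]; [rewrite eqAB => /B'E | rewrite -eqAB => /A'E].
have [K [L [fiK fiL LB KA LK0]]] :=
  shM A' B' (preim_max_fi _ _ _ qpM fiN maxA A'E)
    (preim_max_fi _ _ _ qpM fiN maxB B'E) neqAB'.
have [KN KNE] := submod_im (qproj N) K.
have [LN LNE] := submod_im (qproj N) L.
exists KN, LN; split.
- exact: im_fi KNE.
- exact: im_fi LNE.
- by move=> LNB; apply: LB => x xL; apply/B'E/LNB/LNE; exists x.
- by move=> KNA; apply: KA => x xK; apply/A'E/KNA/KNE; exists x.
- exact: mod_prod_im_eq0 LK0.
Qed.
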